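(* Let $\mathbb{K}$ be a field of characteristic zero, $\mathcal{K}$ a non-empty set of finite groups, and $\ell : \mathbb{N}-\{0\} \to \mathbb{K}^\times$ a monoid homomorphism. If the algebra $\Lambda$ is locally semisimple, then the algebra $\Gamma$ is locally semisimple.
   Context: Subgroups of direct products: for groups $F,G$, elements of $F\times G$ are written $f\times g$, and $\mathcal{S}(F,G)$ is the set of subgroups of $F\times G$. For $U\in\mathcal{S}(F,G)$, put $U_\bullet=\{g\in G: 1\times g\in U\}$, ${}_\bullet U=\{f\in F: f\times 1\in U\}$, and let ${}^\bullet U\leq F$ and $U^\bullet\leq G$ be the images of $U$ under the two projections. For $U\in\mathcal{S}(F,G)$, $V\in\mathcal{S}(G,H)$, the star product $U*V\in\mathcal{S}(F,H)$ is the subgroup of those $f\times h$ for which there exists $g\in G$ with $f\times g\in U$ and $g\times h\in V$. Put $\sigma(U,V)=\ell(|U_\bullet\cap{}_\bullet V|)$. For a finite group $A$, $\ell(A)$ means $\ell(|A|)$. The algebra $\Lambda$ over $\mathbb{K}$ has $\mathbb{K}$-basis consisting of formal symbols $s_U^{F,G}$ with $F,G\in\mathcal{K}$ and $U\in\mathcal{S}(F,G)$, with multiplication $s_U^{F,G}s_V^{G,H}=\sigma(U,V)\,s_{U*V}^{F,H}$, and $s_U^{F,G}s_V^{G',H}=0$ when $G\neq G'$. The algebra $\Gamma$ over $\mathbb{K}$ has $\mathbb{K}$-basis consisting of formal symbols $d_U^{F,G}$ with $F,G\in\mathcal{K}$ and $U$ running over representatives of the $F\times G$-conjugacy classes of subgroups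 of $F\times G$ (with $d_U^{F,G}=d_{U'}^{F,G}$ when $U,U'$ are conjugate in $F \times G$). The multiplication is $$d_U^{F,G}d_V^{G,H}=\sum_{U^\bullet g\,{}^\bullet V\subseteq G}\frac{\ell(U_\bullet\cap{}^g({}_\bullet V))}{|U_\bullet\cap{}^g({}_\bullet V)|}\,d_{U*{}^{g\times1}V}^{F,H},$$ where $g$ runs over representatives of the double cosets of $U^\bullet$ and ${}^\bullet V$ in $G$, and left superscripts denote conjugation (${}^gx=gxg^{-1}$); and $d_U^{F,G}d_V^{G',H}=0$ when $G\neq G'$. This is a well-defined associative algebra. A ring $A$ (not necessarily unital) is locally unital if every finite subset of $A$ is contained in $eAe$ for some idempotent $e$ of $A$. It is locally semisimple if it is locally unital and the unital ring $eAe$ is semisimple for every idempotent $e$ of $A$. *)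

(* Defs.v *)
From HB Require Import structures.
From mathcomp Require Import all_boot all_order all_algebra all_fingroup.
From mathcomp Require Import finmap monalg.

Set Implicit Arguments.
Unset Strict Implicit.
Unset Printing Implicit Defensive.

Import GRing.Theory.
Local Open Scope ring_scope.
Local Open Scope quotient_scope.

(* MathComp has no non-unital rings: a ring is given here by its additive
   group A together with its multiplication mul.  The notions below are meant
   for an associative and biadditive mul. *)
Section LocallySemisimple.

Variables (A : zmodType) (mul : A -> A -> A).

Definition idem (e : A) : Prop := mul e e = e.

(* e A e, a unital ring with unit e *)
Definition corner (e x : A) : Prop := exists a, x = mul (mul e a) e.

Record left_ideal (e : A) (L : A -> Prop) : Prop := LeftIdeal {
  left_ideal_sub : forall x, L x -> corner e x;
  left_ideal0 : L 0;
  left_idealB : forall x y, L x -> L y -> L (x - y);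
  left_idealM : forall a x, corner e a -> L x -> L (mul a x) }.

(* A simple submodule of the left regular module of e A e *)
Record simple_left_ideal (e : A) (L : A -> Prop) : Prop := SimpleLeftIdeal {
  simple_left_idealW : left_ideal e L;
  simple_left_ideal_neq0 : exists2 x, L x & x != 0;
  simple_left_ideal_min : forall M : A -> Prop, left_ideal e M ->
    (forall x, M x -> L x) -> (forall x, M x -> x = 0) \/ (forall x, L x -> M x) }.

(* The left regular module of e A e is an (internal) direct sum of simple
   submodules.  It is generated by e, so such a sum is necessarily finite. *)
Definition semisimple_corner (e : A) : Prop :=
  exists (n : nat) (L : 'I_n -> A -> Prop),
    (forall i, simple_left_ideal e (L i)) /\
    (forall x, corner e x ->
       exists! y : {ffun 'I_n -> A}, (forall i, L i (y i)) /\ x = \sum_i y i).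

Definition locally_unital : Prop :=
  forall s : seq A, exists2 e, idem e & forall x, x \in s -> corner e x.

Definition locally_semisimple : Prop :=
  locally_unital /\ forall e, idem e -> semisimple_corner e.

End LocallySemisimple.

Lemma conjg_pair (A B : finGroupType) (x a : A) (y b : B) :
  (((x, y) : A * B) ^ ((a, b) : A * B) = (x ^ a, y ^ b))%g.
Proof. by []. Qed.

(* For U <= F x G, left_im and right_im are the two projections of U, left_ker
   and right_ker the intersections of U with the two factors. *)
Section StarProduct.

Variables F G H : finGroupType.

Definition left_im (U : {group F * G}) : {set F} := [set u.1 | u in U].
Definition right_im (U : {group F * G}) : {set G} := [set u.2 | u in U].
Definition left_ker (U : {group F * G}) : {set F} := [set f | (f, 1%g) \in U].
Definition right_ker (U : {group F * G}) : {set G} := [set g | (1%g, g) \in U].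

Definition star (U : {group F * G}) (V : {group G * H}) : {set F * H} :=
  [set x | [exists g, ((x.1, g) \in U) && ((g, x.2) \in V)]].

Lemma star_group_set U V : group_set (star U V).
Proof.
apply/group_setP; split=> [|[f h] [f' h']].
  by rewrite inE; apply/existsP; exists 1%g; rewrite /= !group1.
rewrite !inE /= => /existsP[g /andP[Ug Vg]] /existsP[g' /andP[Ug' Vg']].
apply/existsP; exists (g * g')%g.
by rewrite (groupM Ug Ug') (groupM Vg Vg').
Qed.

Canonical star_group U V := Group (star_group_set U V).

Lemma left_im_group_set (U : {group F * G}) : group_set (left_im U).
Proof.
apply/group_setP; split=> [|x y]; first by apply/imsetP; exists 1%g.
case/imsetP=> -[x1 x2] Ux /= -> /imsetP[[y1 y2] Uy /= ->].
by apply/imsetP; exists ((x1 * y1)%g, (x2 * y2)%g) => //; apply: (groupM Ux Uy).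
Qed.

Canonical left_im_group U := Group (left_im_group_set U).

Lemma right_im_group_set (U : {group F * G}) : group_set (right_im U).
Proof.
apply/group_setP; split=> [|x y]; first by apply/imsetP; exists 1%g.
case/imsetP=> -[x1 x2] Ux /= -> /imsetP[[y1 y2] Uy /= ->].
by apply/imsetP; exists ((x1 * y1)%g, (x2 * y2)%g) => //; apply: (groupM Ux Uy).
Qed.

Canonical right_im_group U := Group (right_im_group_set U).

Lemma left_imJ (U : {group F * G}) (a : F * G) :
  left_im (U :^ a)%G = (left_im U :^ a.1)%g.
Proof.
by rewrite /left_im /= -[(U :^ a)%g]/((conjg^~ a) @: U) /conjugate -!imset_comp.
Qed.

Lemma right_imJ (U : {group F * G}) (a : F * G) :
  right_im (U :^ a)%G = (right_im U :^ a.2)%g.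
Proof.
by rewrite /right_im /= -[(U :^ a)%g]/((conjg^~ a) @: U) /conjugate -!imset_comp.
Qed.

Lemma left_kerJ (U : {group F * G}) a b :
  left_ker (U :^ ((a, b) : F * G))%G = (left_ker U :^ a)%g.
Proof.
apply/setP=> z; rewrite mem_conjg !inE mem_conjg.
by rewrite [X in X \in _](conjg_pair z a^-1%g 1%g b^-1%g) conj1g.
Qed.

Lemma right_kerJ (U : {group F * G}) a b :
  right_ker (U :^ ((a, b) : F * G))%G = (right_ker U :^ b)%g.
Proof.
apply/setP=> z; rewrite mem_conjg !inE mem_conjg.
by rewrite [X in X \in _](conjg_pair 1%g a^-1%g z b^-1%g) conj1g.
Qed.

Lemma starJ (U : {group F * G}) (V : {group G * H}) a b c :
  star_group (U :^ ((a, b) : F * G)) (V :^ ((b, c) : G * H)) =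
  (star_group U V :^ ((a, c) : F * H))%G.
Proof.
apply: val_inj => /=; apply/setP=> -[z w]; rewrite mem_conjg.
rewrite [X in _ = (X \in _)](conjg_pair z a^-1%g w c^-1%g) !inE /=.
have memU t : ((z, t) \in (U :^ ((a, b) : F * G))%g) = ((z ^ a^-1, t ^ b^-1)%g \in U).
  by rewrite mem_conjg (conjg_pair z a^-1%g t b^-1%g).
have memV t : ((t, w) \in (V :^ ((b, c) : G * H))%g) = ((t ^ b^-1, w ^ c^-1)%g \in V).
  by rewrite mem_conjg (conjg_pair t b^-1%g w c^-1%g).
apply/existsP/existsP => -[t]; [exists (t ^ b^-1)%g|exists (t ^ b)%g].
  by rewrite -memU -memV.
by rewrite memU memV conjgK.
Qed.

End StarProduct.

Section Algebras.

(* The set of finite groups is the family (G i)_(i : I); groups with different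
   indices count as different, even when they are isomorphic. *)
Variables (K : fieldType) (I : choiceType) (G : I -> finGroupType).
(* l stands for a monoid homomorphism on the positive integers; it is only ever
   evaluated at orders of groups, so that l 0 is irrelevant. *)
Variable l : nat -> K.

Definition symb := {p : I * I & {group G p.1 * G p.2}}.

HB.instance Definition _ := Choice.on symb.

Definition Symb f g (U : {group G f * G g}) : symb :=
  @existT (I * I) (fun p => {group G p.1 * G p.2}) (f, g) U.

(* m U V if the groups in the middle agree, and 0 otherwise; ecast transports V
   along the equality of the indices. *)
Definition glue (Z : zmodType)
    (m : forall f g h, {group G f * G g} -> {group G g * G h} -> Z)
    (x y : symb) : Z :=
  let: existT p U := x in
  let: existT q V := y in
  match eq_comparable p.2 q.1 with
  | left e => m p.1 p.2 q.2 U (ecast g {group G g * G q.2} (esym e) V)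
  | right _ => 0
  end.

Definition bilin (B : choiceType) (m : B -> B -> {malg K[B]})
    (x y : {malg K[B]}) : {malg K[B]} :=
  \sum_(b <- msupp x) \sum_(c <- msupp y) (x@_b * y@_c) *: m b c.

Lemma bilinU (B : choiceType) (m : B -> B -> {malg K[B]}) (b c : B) :
  bilin m << b >> << c >> = m b c.
Proof.
rewrite /bilin !msuppU (negPf (oner_neq0 K)) !big_seq_fset1 !mcoeffUU.
by rewrite mulr1 scale1r.
Qed.

Lemma malgU_inj (B : choiceType) : injective (fun b : B => << b >> : {malg K[B]}).
Proof.
move=> b c bc; apply/eqP/idPn => /negPf b_c; have := oner_neq0 K.
by rewrite -(mcoeffUU b 1) bc mcoeffU [c == b]eq_sym b_c eqxx.
Qed.

Definition Lambda := {malg K[symb]}.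

Definition sgen f g (U : {group G f * G g}) : Lambda := << Symb U >>.

Definition sigma f g h (U : {group G f * G g}) (V : {group G g * G h}) : K :=
  l #|right_ker U :&: left_ker V|.

Definition Lambda_mul : Lambda -> Lambda -> Lambda :=
  bilin (glue (fun f g h U V => sigma U V *: sgen (star_group U V))).

Lemma sgenM f g h (U : {group G f * G g}) (V : {group G g * G h}) :
  Lambda_mul (sgen U) (sgen V) = sigma U V *: sgen (star_group U V).
Proof.
rewrite /Lambda_mul [LHS]bilinU /=.
by case: (eq_comparable g g) => [e|//]; rewrite (eq_axiomK e).
Qed.

Lemma sgenM0 f g g' h (U : {group G f * G g}) (V : {group G g' * G h}) :
  g <> g' -> Lambda_mul (sgen U) (sgen V) = 0.
Proof.
by move=> gg'; rewrite /Lambda_mul [LHS]bilinU /=; case: (eq_comparable g g').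
Qed.

Definition conj_symb (x y : symb) : bool :=
  let: existT p U := x in
  [exists a : G p.1 * G p.2, y == Symb (U :^ a)%G].

Lemma conj_symb_equiv : equiv_class_of conj_symb.
Proof.
have refl : reflexive conj_symb.
  move=> [[f g] U]; apply/existsP; exists 1%g; apply/eqP.
  by congr existT; apply: val_inj; rewrite /= conjsg1.
have sym x y : conj_symb x y -> conj_symb y x.
  case: x => -[f g] U /existsP[/= a /eqP->]; apply/existsP; exists a^-1%g.
  by apply/eqP; congr existT; apply: val_inj; rewrite /= conjsgK.
split=> //.
  by move=> x y; apply/idP/idP; apply: sym.
move=> y [[f g] U] z /existsP[/= a /eqP->] /existsP[/= b /eqP->].
apply/existsP; exists (a * b)%g.
by apply/eqP; congr existT; apply: val_inj; rewrite /= conjsgM.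
Qed.

Canonical conj_symb_equiv_rel := EquivRelPack conj_symb_equiv.

Definition csymb := {eq_quot conj_symb}.

HB.instance Definition _ := Choice.on csymb.
HB.instance Definition _ := EqQuotient.on csymb.

Definition Gamma := {malg K[csymb]}.

Definition dgen f g (U : {group G f * G g}) : Gamma :=
  << \pi_csymb (Symb U) >>.

Lemma dgen_eq f g (U U' : {group G f * G g}) :
  dgen U = dgen U' <-> exists a : G f * G g, U' = (U :^ a)%G.
Proof.
have conjP : conj_symb (Symb U) (Symb U') <-> exists a, U' = (U :^ a)%G.
  split=> [/existsP[/= a]|[a ->]]; last by apply/existsP; exists a.
  pose T (p : I * I) : eqType := {group G p.1 * G p.2}.
  by rewrite (@eq_Tagged _ T (Symb U') (U :^ a)%G) => /eqP/= ->; exists a.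
split=> [/malgU_inj/eqmodP/conjP//|/conjP cU].
by apply: (congr1 (fun b : csymb => << b >> : Gamma)); apply/eqmodP.
Qed.

(* The summand at the representative x of a double coset; MathComp's x ^ y is
   y^-1 x y, whence the inverses. *)
Definition dterm f g h (U : {group G f * G g}) (V : {group G g * G h})
    (x : G g) : Gamma :=
  let n := #|right_ker U :&: (left_ker V :^ x^-1)%g| in
  (l n / n%:R) *: dgen (star_group U (V :^ ((x, 1%g) : G g * G h)^-1)%G).

Definition dmul f g h (U : {group G f * G g}) (V : {group G g * G h}) : Gamma :=
  \sum_(D in [set (right_im U :* x * left_im V)%g | x : G g])
    dterm U V (fingroup.repr D).

(* The formula is applied to chosen representatives of the two classes; it does
   not depend on them, see dgenM below. *)
Definition Gamma_mul : Gamma -> Gamma -> Gamma :=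
  bilin (fun b c : csymb =>
           glue dmul (generic_quotient.repr b) (generic_quotient.repr c)).

Lemma dtermJ f g h (U : {group G f * G g}) (V : {group G g * G h}) a b u x v :
  u \in right_im U -> v \in left_im V ->
  dterm (U :^ a) (V :^ b) (a.2^-1 * (u * x * v) * b.1)%g = dterm U V x.
Proof.
case/imsetP=> -[p u'] Upu /= ->{u}; case/imsetP=> -[v' q] Vvq /= ->{v}.
case: a b => [a1 a2] [b1 b2] /=.
pose m := (u'^-1 * a2)%g.
have eqU : (U :^ (a1, a2))%G = (U :^ (((p^-1 * a1)%g, m) : G f * G g))%G.
  apply: val_inj => /=; rewrite -[in LHS](conjGid (groupVr Upu)) -conjsgM.
  by congr (U :^ _)%g.
set y := (_ * b1)%g; pose W := (V :^ ((x, 1%g) : G g * G h)^-1)%G.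
have eqV : ((V :^ (b1, b2)) :^ ((y, 1%g) : G g * G h)^-1)%G
         = (W :^ ((m, (q * b2)%g) : G g * G h))%G.
  apply: val_inj => /=; rewrite -[in LHS](conjGid Vvq) -!conjsgM.
  congr (V :^ _)%g; apply/eqP; rewrite xpair_eqE /= !(invg1, mulg1, mul1g) eqxx andbT.
  by rewrite /y /m !invMg !invgK !mulgA mulgK mulgV mul1g.
have eqn : #|right_ker (U :^ (a1, a2)) :&: (left_ker (V :^ (b1, b2)) :^ y^-1)%g|
         = #|right_ker U :&: (left_ker V :^ x^-1)%g|.
  have lkW : left_ker W = (left_ker V :^ x^-1)%g := left_kerJ V x^-1%g 1^-1%g.
  have -> : (left_ker (V :^ (b1, b2)) :^ y^-1 = left_ker W :^ m)%g.
    by rewrite -(left_kerJ W m (q * b2)%g) -eqV -(left_kerJ _ _ 1^-1%g).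
  by rewrite eqU right_kerJ -conjIg cardJg lkW.
rewrite /dterm eqn.
suff -> : dgen (star_group (U :^ (a1, a2)) ((V :^ (b1, b2)) :^ ((y, 1%g) : G g * G h)^-1))
        = dgen (star_group U W) by [].
symmetry; apply/dgen_eq; exists ((p^-1 * a1)%g, (q * b2)%g).
by rewrite -(starJ U W _ m) -eqV -eqU.
Qed.

Lemma sum_imset (T : finType) (Z : zmodType) (A : {set T}) (c : T -> T) (P Q : T -> Z) :
  injective c -> {in A, forall x, P (c x) = Q x} ->
  \sum_(x in c @: A) P x = \sum_(x in A) Q x.
Proof.
move=> c_inj PQ; rewrite big_imset; last by move=> ? ? _ _; apply: c_inj.
exact: eq_bigr.
Qed.

Lemma dmulJ f g h (U : {group G f * G g}) (V : {group G g * G h}) a b :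
  dmul (U :^ a) (V :^ b) = dmul U V.
Proof.
pose c (D : {set G g}) := (a.2^-1 *: D :* b.1)%g.
have cE x : (right_im (U :^ a) :* (a.2^-1 * x * b.1) * left_im (V :^ b))%g
          = c (right_im U :* x * left_im V)%g.
  rewrite right_imJ left_imJ !conjsgE /c -!mulg_set1 !mulgA.
  rewrite -(mulgA _ [set a.2] [set a.2^-1]%g) mulg_set1 mulgV mulg1.
  by rewrite -(mulgA _ [set b.1] [set b.1^-1]%g) mulg_set1 mulgV mulg1.
have c_inj : injective c.
  by move=> D D' /(can_inj (rcosetK b.1))/(can_inj (lcosetK a.2^-1%g)).
rewrite /dmul.
have -> : [set (right_im (U :^ a) :* x * left_im (V :^ b))%g | x : G g]
  = c @: [set (right_im U :* x * left_im V)%g | x : G g].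
  rewrite -imset_comp; apply/setP=> D; apply/imsetP/imsetP=> -[x _ ->].
    exists (a.2 * x * b.1^-1)%g => //.
    by rewrite /= -cE !mulgA mulVg mul1g mulgKV.
  by exists (a.2^-1 * x * b.1)%g; rewrite ?cE.
apply: (sum_imset c_inj) => _ /imsetP[x _ ->]; set D := (_ * _)%g.
have inD y : y \in D -> exists u v,
    [/\ u \in right_im U, v \in left_im V & y = (u * x * v)%g].
  by case/mulsgP=> _ v /rcosetP[u Uu ->] Vv ->; exists u, v.
have Dx : x \in D by rewrite -[x]mulg1 mem_mulg ?group1 // rcoset_refl.
have [u [v [Uu Vv reprD]]] := inD _ (mem_repr _ Dx).
have cDx : (a.2^-1 * x * b.1)%g \in c D.
  by rewrite mem_rcoset mulgK mem_lcoset invgK mulKVg.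
have := mem_repr _ cDx; rewrite {1}/c mem_rcoset mem_lcoset invgK.
case/inD=> u' [v' [Uu' Vv' e]].
have -> : fingroup.repr (c D)
    = (a.2^-1 * ((u' * u^-1) * fingroup.repr D * (v^-1 * v')) * b.1)%g.
  have -> : (u' * u^-1 * fingroup.repr D * (v^-1 * v') = u' * x * v')%g.
    by rewrite reprD !mulgA mulgKV mulgK.
  by rewrite -e mulKg mulgKV.
by apply: dtermJ; rewrite groupM ?groupV.
Qed.

Lemma repr_csymb f g (U : {group G f * G g}) :
  exists a, generic_quotient.repr (\pi_csymb (Symb U)) = Symb (U :^ a)%G.
Proof.
have /eqmodP : Symb U = generic_quotient.repr (\pi_csymb (Symb U)) %[mod csymb].
  by rewrite reprK.
by case/existsP=> /= a /eqP; exists a.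
Qed.

Lemma dgenM f g h (U : {group G f * G g}) (V : {group G g * G h}) :
  Gamma_mul (dgen U) (dgen V) = dmul U V.
Proof.
rewrite /Gamma_mul [LHS]bilinU.
have [a ->] := repr_csymb U; have [b ->] := repr_csymb V.
rewrite /=; case: (eq_comparable g g) => [e|//]; rewrite (eq_axiomK e) /=.
exact: dmulJ.
Qed.

Lemma dgenM0 f g g' h (U : {group G f * G g}) (V : {group G g' * G h}) :
  g <> g' -> Gamma_mul (dgen U) (dgen V) = 0.
Proof.
move=> gg'; rewrite /Gamma_mul [LHS]bilinU.
have [a ->] := repr_csymb U; have [b ->] := repr_csymb V.
by rewrite /=; case: (eq_comparable g g').
Qed.

End Algebras.

(* Main.v *)
Require Import Defs.
From HB Require Import structures.
From mathcomp Require Import all_boot all_order all_algebra all_fingroup.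
From mathcomp Require Import finmap monalg ring.
Import GRing.Theory.
Local Open Scope ring_scope.
Set Implicit Arguments.
Unset Strict Implicit.
Unset Printing Implicit Defensive.

(** The algebra Gamma embeds in Lambda.  For x in F let Delta_x <= F x F be the
    graph of conjugation by x.  Multiplying by the symbol of Delta_x, on either
    side, conjugates the other factor and carries no scalar, because Delta_x
    meets both factors of F x F trivially.  Hence
    e_F = |F|^-1 sum_x s_(Delta_x) is idempotent, and e_F s_U e_G is the average
    of s_U over its F x G-conjugacy class.  The map

      d_U |-> |G| / |U| . e_F s_U e_G = (|F||U|)^-1 . sum_(a in F x G) s_(U^a)

    ([embed]) is injective, with linear left inverse [retract], which sends s_U
    to |U| / |G| . d_U ([embedK]).

    It is multiplicative ([embedM]).  Expanding a product of two class sums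
    gives a sum over all x in G ([orbit_sumM]), whereas the product in Gamma runs
    over double cosets, so that the size of each double coset enters as a weight
    ([dmul_sum]).  The weights agree because of the counting formula

      |U. * .V| |U * V| |U_ker :&: V_ker| = |U| |V|

    ([card_star]), where U. and .V are the projections to G and U_ker, V_ker are
    the intersections with G; it follows from counting in two ways the triples
    (f, h, g) with (f, g) in U and (g, h) in V.

    The image of Gamma contains e Lambda e for each idempotent e in the image:
    in a product (e b) e' with e, e' in the image, b may be replaced by its
    average over conjugates, which is embed (retract b) ([embed_retractM]).  So
    an idempotent e of Gamma has e Gamma e isomorphic to the corner of Lambda at
    embed e ([corner_embed]), and semisimplicity is transported along this
    isomorphism ([semisimple_corner_preim]).  Finally, the sums of finitely many
    identities d_(Delta_1) are local units of Gamma ([Gamma_locally_unital]). *)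

(** * Transport of semisimplicity between corners *)

Section Transport.

Variables (A B : zmodType) (mulA : A -> A -> A) (mulB : B -> B -> B).
Variables (f : {additive A -> B}) (f_inj : injective f).
Hypothesis fM : forall x y, f (mulA x y) = mulB (f x) (f y).

Variable e : A.
Hypothesis corner_lift :
  forall y, corner mulB (f e) y -> exists2 x, corner mulA e x & y = f x.

Lemma corner_morph x : corner mulA e x -> corner mulB (f e) (f x).
Proof. by case=> a ->; exists (f a); rewrite !fM. Qed.

(** With [left_ideal_image], this matches the left ideals of the two corners:
    [f] restricts to a bijection between them, by [corner_lift]. *)
Lemma left_ideal_preim L :
  left_ideal mulB (f e) L -> left_ideal mulA e (fun x => L (f x)).
Proof.
case=> Lsub L0 LB LM; split=> [x /Lsub/corner_lift[x' ex' /f_inj->] //|||].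
- by rewrite raddf0.
- by move=> x y Lx Ly; rewrite raddfB; apply: LB.
- by move=> a x /corner_morph ea Lx; rewrite fM; apply: LM.
Qed.

Lemma left_ideal_image M : left_ideal mulA e M ->
  left_ideal mulB (f e) (fun y => exists2 x, M x & y = f x).
Proof.
case=> Msub M0 MB MM; split.
- by move=> _ [x /Msub/corner_morph ex ->].
- by exists 0; rewrite ?raddf0.
- by move=> _ _ [x Mx ->] [y My ->]; exists (x - y); rewrite ?raddfB //; apply: MB.
- move=> _ _ /corner_lift[a ea ->] [x Mx ->].
  by exists (mulA a x); rewrite ?fM //; apply: MM.
Qed.

Lemma simple_left_ideal_preim L : simple_left_ideal mulB (f e) L ->
  simple_left_ideal mulA e (fun x => L (f x)).
Proof.
case=> Lid [y Ly y0] Lmin; split; first exact: left_ideal_preim.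
  have [x _ eq_y] := corner_lift (left_ideal_sub Lid Ly).
  exists x; rewrite -?eq_y //.
  by apply: contraNneq y0 => x0; rewrite eq_y x0 raddf0.
move=> M Mid MsubL.
have [|M0|LM] := Lmin _ (left_ideal_image Mid).
- by move=> _ [x Mx ->]; apply: MsubL.
- by left=> x Mx; apply: f_inj; rewrite raddf0; apply: M0; exists x.
- by right=> x /LM[x' Mx' /f_inj->].
Qed.

(** A decomposition of the target corner pulls back summand by summand, since
    every component of [f x] lies in the target corner and so is in the image of
    [f]; its preimage is unique by injectivity. *)
Lemma semisimple_corner_preim :
  semisimple_corner mulB (f e) -> semisimple_corner mulA e.
Proof.
case=> n [L [Lsimple Ldec]]; exists n, (fun i x => L i (f x)).
split=> [i|x ex]; first exact: simple_left_ideal_preim.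
have [y [[Ly fx] y_uniq]] := Ldec _ (corner_morph ex).
have /fin_all_exists[z fz] i : exists z, y i = f z.
  have Lid := simple_left_idealW (Lsimple i).
  by have [z _] := corner_lift (left_ideal_sub Lid (Ly i)); exists z.
exists [ffun i => z i]; split=> [|z' [Lz' xz']].
  split=> [i|]; first by rewrite ffunE -fz.
  apply: f_inj; rewrite fx raddf_sum.
  by apply: eq_bigr => i _; rewrite ffunE fz.
apply/ffunP=> i; rewrite ffunE; apply: f_inj; rewrite -fz.
rewrite (y_uniq [ffun i => f (z' i)]) ?ffunE //; split=> [j|].
  by rewrite ffunE.
by rewrite xz' raddf_sum; apply: eq_bigr => j _; rewrite ffunE.
Qed.

End Transport.

(** * Linear maps out of a free module *)

Section LinearProps.

Variables (K : fieldType) (A C : lmodType K).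

Lemma scale_congr (a b : K) (x : A) : a = b -> a *: x = b *: x.
Proof. by move=> ->. Qed.

Lemma lin0 (f : A -> C) : linear f -> f 0 = 0.
Proof. by move/(_ (-1) 0 0); rewrite scaler0 addr0 scaleN1r addNr. Qed.

Lemma linZ (f : A -> C) : linear f -> forall a x, f (a *: x) = a *: f x.
Proof. by move=> flin a x; rewrite -[a *: x]addr0 flin (lin0 flin) addr0. Qed.

Lemma lin_sum (f : A -> C) : linear f -> forall (T : Type) (r : seq T) P F,
  f (\sum_(i <- r | P i) F i) = \sum_(i <- r | P i) f (F i).
Proof.
move=> flin T r P F; apply: (big_morph f _ (lin0 flin)) => x y.
by rewrite -[x]scale1r flin !scale1r.
Qed.

End LinearProps.

Section LinearExtension.

Variables (K : fieldType) (B : choiceType) (V : lmodType K).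

Definition lext (h : B -> V) (x : {malg K[B]}) : V :=
  \sum_(b <- msupp x) x@_b *: h b.

Lemma lext_wide h (d : {fset B}) x : (msupp x `<=` d)%fset ->
  lext h x = \sum_(b <- d) x@_b *: h b.
Proof.
move=> xd; rewrite /lext; apply/big_fset_incl => // b _ /mcoeff_outdom ->.
by rewrite scale0r.
Qed.

Lemma lext_is_linear h : linear (lext h).
Proof.
move=> a x y; set d := (msupp x `|` msupp y)%fset.
rewrite !(@lext_wide _ d) ?fsubsetUl ?fsubsetUr //.
  rewrite scaler_sumr -big_split; apply: eq_bigr => b _ /=.
  by rewrite mcoeffD mcoeffZ scalerDl scalerA.
apply: fsubset_trans (msuppD_le _ _) _.
exact: fsetSU (msuppZ_le _ _).
Qed.

HB.instance Definition _ h :=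
  GRing.isLinear.Build K {malg K[B]} V *:%R (lext h) (lext_is_linear h).

Lemma lextU h b : lext h << b >> = h b.
Proof. by rewrite /lext msuppU oner_eq0 big_seq_fset1 mcoeffUU scale1r. Qed.

Lemma malg_basisE (x : {malg K[B]}) : x = \sum_(b <- msupp x) x@_b *: << b >>.
Proof.
rewrite {1}[x]monalgE; apply: eq_bigr => b _.
by apply/malgP=> c; rewrite mcoeffZ !mcoeffU mulrnAr mulr1.
Qed.

Lemma eq_linear_basis (f g : {malg K[B]} -> V) : linear f -> linear g ->
  (forall b, f << b >> = g << b >>) -> f =1 g.
Proof.
move=> flin glin fg x.
rewrite (malg_basisE x) !lin_sum //; apply: eq_bigr => b _.
by rewrite !linZ // fg.
Qed.

End LinearExtension.

Section Bilinear.

Variables (K : fieldType) (B : choiceType) (m : B -> B -> {malg K[B]}).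

Lemma bilinEl x y : bilin m x y = lext (fun b => lext (m b) y) x.
Proof.
apply: eq_bigr => b _; rewrite scaler_sumr.
by apply: eq_bigr => c _; rewrite scalerA.
Qed.

Lemma bilinEr x y : bilin m x y = lext (fun c => lext (m^~ c) x) y.
Proof.
rewrite /bilin exchange_big; apply: eq_bigr => c _ /=.
by rewrite scaler_sumr; apply: eq_bigr => b _; rewrite scalerA mulrC.
Qed.

Lemma bilinPl y : linear (bilin m ^~ y).
Proof. by move=> a u v; rewrite !bilinEl linearP. Qed.

Lemma bilinPr x : linear (bilin m x).
Proof. by move=> a u v; rewrite !bilinEr linearP. Qed.

End Bilinear.

(** * Orders of star products *)

Section Orders.

Variables F G H : finGroupType.

(** The right kernel of [X] is the kernel of the first projection of [X]. *)
Lemma card_left_im (X : {group F * G}) : (#|left_im X| * #|right_ker X|)%N = #|X|.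
Proof.
have -> : left_im X = (@fst F G @* X)%g by rewrite morphimE setTI.
rewrite card_morphim setTI mulnC.
have -> : #|right_ker X| = #|X :&: ('ker (@fst F G))%g|.
  have inj1 : injective (fun g : G => (1%g : F, g)) by move=> g g' [].
  rewrite -(card_imset _ inj1); apply: eq_card => -[f g].
  rewrite !inE /=; apply/imsetP/andP => [[g']|[Xfg /eqP/= f1]].
    by rewrite inE => Xg' [-> ->].
  by exists g; rewrite ?inE -?f1.
exact: LagrangeI.
Qed.

Lemma card_right_im (X : {group F * G}) : (#|right_im X| * #|left_ker X|)%N = #|X|.
Proof.
have -> : right_im X = (@snd F G @* X)%g by rewrite morphimE setTI.
rewrite card_morphim setTI mulnC.
have -> : #|left_ker X| = #|X :&: ('ker (@snd F G))%g|.
  have inj1 : injective (fun f : F => (f, 1%g : G)) by move=> f f' [].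
  rewrite -(card_imset _ inj1); apply: eq_card => -[f g].
  rewrite !inE /=; apply/imsetP/andP => [[f']|[Xfg /eqP/= g1]].
    by rewrite inE => Xf' [-> ->].
  by exists f; rewrite ?inE -?g1.
exact: LagrangeI.
Qed.

End Orders.

Section StarOrder.

Variables (F G H : finGroupType) (U : {group F * G}) (V : {group G * H}).

(** The coordinates are grouped as (f, h), g so that the star product is the
    left projection of this group. *)
Definition fibre_product : {set (F * H) * G} :=
  [set x | ((x.1.1, x.2) \in U) && ((x.2, x.1.2) \in V)].

Lemma fibre_product_group_set : group_set fibre_product.
Proof.
apply/group_setP; split=> [|[[f h] g] [[f' h'] g']]; first by rewrite inE !group1.
rewrite !inE /= => /andP[Ufg Vgh] /andP[Ufg' Vgh'].
by rewrite (groupM Ufg Ufg') (groupM Vgh Vgh').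
Qed.

Canonical fibre_product_group := Group fibre_product_group_set.

(** Both sides are the order of the fibre product, fibred over its projection to
    [F * H] on the left and over its projection to [G] on the right. *)
Lemma card_fibre_product :
  (#|star U V| * #|right_ker U :&: left_ker V|)%N
  = (#|right_im U :&: left_im V| * (#|left_ker U| * #|right_ker V|))%N.
Proof.
have := card_left_im fibre_product_group.
rewrite -(card_right_im fibre_product_group).
have -> : left_im fibre_product_group = star U V.
  apply/setP=> -[f h]; rewrite inE; apply/imsetP/existsP => /=.
    by case=> -[[f' h'] g]; rewrite inE /= => UV [-> ->]; exists g.
  by case=> g UV; exists ((f, h), g); rewrite ?inE.
have -> : right_im fibre_product_group = right_im U :&: left_im V.
  apply/setP=> g; rewrite inE; apply/imsetP/andP => /=.
    case=> -[[f h] g']; rewrite inE /= => /andP[Uf Vh] ->.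
    by split; apply/imsetP; [exists (f, g')|exists (g', h)].
  case=> /imsetP[[f g1] Uf /= g_g1] /imsetP[[g2 h] Vh /= g_g2].
  by exists ((f, h), g); rewrite // inE /= {1}g_g1 {1}g_g2 Uf.
have -> : right_ker fibre_product_group = right_ker U :&: left_ker V.
  by apply/setP=> g; rewrite !inE.
have -> : left_ker fibre_product_group = setX (left_ker U) (right_ker V).
  by apply/setP=> -[f h]; rewrite !inE.
by rewrite cardsX.
Qed.

(** The identity which makes the structure constants of the two algebras agree. *)
Lemma card_star :
  (#|right_im U * left_im V|%g * #|star U V| * #|right_ker U :&: left_ker V|)%N
  = (#|U| * #|V|)%N.
Proof.
rewrite -mulnA card_fibre_product mulnA -mul_cardG -(card_right_im U) -(card_left_im V).
by rewrite mulnACA.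
Qed.

End StarOrder.

Lemma conjG_id (gT : finGroupType) (A : {group gT}) : (A :^ 1%g)%G = A.
Proof. by apply: val_inj; rewrite /= conjsg1. Qed.

Lemma conjG_conjG (gT : finGroupType) (A : {group gT}) x y :
  ((A :^ x) :^ y)%G = (A :^ (x * y)%g)%G.
Proof. by apply: val_inj; rewrite /= conjsgM. Qed.

Lemma sum_pair (Z : zmodType) (S T : finType) (F : S * T -> Z) :
  \sum_p F p = \sum_a \sum_b F (a, b).
Proof.
by rewrite (pair_bigA _ (fun a b => F (a, b))); apply: eq_bigr => -[].
Qed.

Section CharacteristicZero.

Variable K : fieldType.
Hypothesis K_char0 : [pchar K] =i pred0.

Lemma natr_neq0 n : (0 < n)%N -> n%:R != 0 :> K.
Proof. by have /pcharf0P-> := K_char0; rewrite -lt0n. Qed.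

Lemma natr_card_neq0 (gT : finGroupType) (A : {group gT}) : #|A|%:R != 0 :> K.
Proof. exact/natr_neq0/cardG_gt0. Qed.

Lemma natr_cardT_neq0 (gT : finGroupType) : #|gT|%:R != 0 :> K.
Proof. by rewrite -cardsT natr_card_neq0. Qed.

End CharacteristicZero.

(** * Sums over conjugacy classes *)

Section OrbitSums.

Variables (K : fieldType) (I : choiceType) (G : I -> finGroupType) (l : nat -> K).
(* Only bilinearity and the two multiplication rules of the symbols matter here,
   so the algebra is an arbitrary module with a product. *)
Variables (L : lmodType K) (mul : L -> L -> L).
Variable s : forall f g, {group G f * G g} -> L.
Hypothesis mulPl : forall y, linear (mul ^~ y).
Hypothesis mulPr : forall x, linear (mul x).
Hypothesis sM : forall f g h (U : {group G f * G g}) (V : {group G g * G h}),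
  mul (s U) (s V) = sigma l U V *: s (star_group U V).
Hypothesis sM0 : forall f g g' h (U : {group G f * G g}) (V : {group G g' * G h}),
  g <> g' -> mul (s U) (s V) = 0.

Lemma mul_suml (T : finType) (F : T -> L) y :
  mul (\sum_i F i) y = \sum_i mul (F i) y.
Proof. exact: (lin_sum (mulPl y)). Qed.

Lemma mul_sumr (T : finType) x (F : T -> L) :
  mul x (\sum_i F i) = \sum_i mul x (F i).
Proof. exact: (lin_sum (mulPr x)). Qed.

Lemma mulZl a x y : mul (a *: x) y = a *: mul x y.
Proof. exact: (linZ (mulPl y)). Qed.

Lemma mulZr a x y : mul x (a *: y) = a *: mul x y.
Proof. exact: (linZ (mulPr x)). Qed.

Lemma sigmaJ f g h (U : {group G f * G g}) (V : {group G g * G h}) a b c :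
  sigma l (U :^ ((a, b) : G f * G g)) (V :^ ((b, c) : G g * G h)) = sigma l U V.
Proof. by rewrite /sigma right_kerJ left_kerJ -conjIg cardJg. Qed.

(** Summing over conjugating elements rather than over the class counts each
    conjugate as often as the order of the normaliser of [U]; the sum is
    |F||G| e_F s_U e_G. *)
Definition orbit_sum f g (U : {group G f * G g}) : L :=
  \sum_(a : G f * G g) s (U :^ a).

Lemma sum_conjJ (T : zmodType) f g (U : {group G f * G g}) a
    (F : {group G f * G g} -> T) :
  \sum_(b : G f * G g) F (U :^ b)%G = \sum_(b : G f * G g) F ((U :^ b) :^ a)%G.
Proof.
rewrite (reindex_inj (mulIg a)) /=.
by apply: eq_bigr => b _; rewrite conjG_conjG.
Qed.

Lemma orbit_sumM0 f g g' h (U : {group G f * G g}) (V : {group G g' * G h}) :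
  g <> g' -> mul (orbit_sum U) (orbit_sum V) = 0.
Proof.
move=> ne; rewrite mul_suml big1 // => a _; rewrite mul_sumr big1 // => b _.
exact: sM0.
Qed.

Lemma orbit_sumJ f g (U : {group G f * G g}) a :
  orbit_sum (U :^ a) = orbit_sum U.
Proof.
rewrite /orbit_sum [RHS](reindex_inj (mulgI a)).
by apply: eq_bigr => b _; rewrite conjG_conjG.
Qed.

(** A class sum absorbs, on its inner side, conjugation of the other factor:
    conjugating both middle components by [c] changes neither the scalar nor the
    star product, and only permutes the class sum. *)
Lemma orbit_sumMJ f g g' h (U : {group G f * G g}) (V : {group G g' * G h}) c :
  mul (orbit_sum U) (s (V :^ ((c, 1%g) : G g' * G h))) = mul (orbit_sum U) (s V).
Proof.
rewrite !mul_suml; case: (eq_comparable g g') => [e|ne]; last first.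
  by rewrite !big1 // => a _; rewrite sM0.
case: g' / e V c => V c; rewrite (sum_conjJ U (1%g, c) (fun X => mul (s X) _)).
apply: eq_bigr => a _; rewrite !sM.
by rewrite (starJ (U :^ a) V 1%g c 1%g) (sigmaJ (U :^ a) V 1%g c 1%g) conjG_id.
Qed.

Lemma Jorbit_sumM f g g' h (U : {group G f * G g}) (V : {group G g' * G h}) c :
  mul (s (U :^ ((1%g, c) : G f * G g))) (orbit_sum V) = mul (s U) (orbit_sum V).
Proof.
rewrite !mul_sumr; case: (eq_comparable g g') => [e|ne]; last first.
  by rewrite !big1 // => a _; rewrite sM0.
case: g' / e V => V; rewrite (sum_conjJ V (c, 1%g) (fun X => mul _ (s X))).
apply: eq_bigr => a _; rewrite !sM.
by rewrite (starJ U (V :^ a) 1%g c 1%g) (sigmaJ U (V :^ a) 1%g c 1%g) conjG_id.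
Qed.

(** Conjugation of the middle factor by (c1, c2) is undone by the left class sum
    in the first component and by the right one in the second. *)
Lemma orbit_sumMJM f g g' h h' k (U : {group G f * G g})
    (V : {group G g' * G h}) (W : {group G h' * G k}) c :
  mul (mul (orbit_sum U) (s (V :^ c))) (orbit_sum W) =
  mul (mul (orbit_sum U) (s V)) (orbit_sum W).
Proof.
case: c => c1 c2.
have -> : (V :^ ((c1, c2) : G g' * G h))%G
        = ((V :^ ((1%g, c2) : G g' * G h)) :^ ((c1, 1%g) : G g' * G h))%G.
  by rewrite conjG_conjG; congr (V :^ _)%G; congr pair; rewrite ?mul1g ?mulg1.
rewrite orbit_sumMJ ![mul (orbit_sum U) _]mul_suml ![mul _ (orbit_sum W)]mul_suml.
apply: eq_bigr => a _.
case: (eq_comparable g g') => [e|ne]; last by rewrite !sM0.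
case: g' / e c1 V => c1 V.
rewrite -[in LHS](conjG_id (U :^ a)) !sM (starJ (U :^ a) V 1%g 1%g c2).
by rewrite (sigmaJ (U :^ a) V 1%g 1%g c2) !mulZl Jorbit_sumM.
Qed.

(** Between two class sums, a symbol can be replaced by its average over
    conjugates; this is how e_F y e_G depends only on the average of y. *)
Lemma orbit_sum_average f g g' h h' k (U : {group G f * G g})
    (V : {group G g' * G h}) (W : {group G h' * G k}) a b c :
  mul (mul (a *: orbit_sum U) (b *: orbit_sum V)) (c *: orbit_sum W) =
  (b * (#|G g'| * #|G h|)%:R) *:
    mul (mul (a *: orbit_sum U) (s V)) (c *: orbit_sum W).
Proof.
rewrite !mulZr !mulZl [mul (orbit_sum U) (orbit_sum V)]mul_sumr.
rewrite [mul _ (orbit_sum W)]mul_suml; under eq_bigr do rewrite orbit_sumMJM.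
by rewrite sumr_const card_prod -scaler_nat !scalerA; congr (_ *: _); ring.
Qed.

(** The product of the symbols of U^(a, b) and V^(c, d) depends on the middle
    conjugations only through x = b c^-1: moving (b, d) out of the second factor
    leaves V^(x^-1, 1), and every x arises from |G| pairs (b, c). *)
Lemma orbit_sumM f g h (U : {group G f * G g}) (V : {group G g * G h}) :
  mul (orbit_sum U) (orbit_sum V) =
  #|G g|%:R *: \sum_(x : G g)
     sigma l U (V :^ ((x, 1%g) : G g * G h)^-1)%G *:
       orbit_sum (star_group U (V :^ ((x, 1%g) : G g * G h)^-1)%G).
Proof.
pose W x := (V :^ ((x, 1%g) : G g * G h)^-1)%G.
pose T x a c := sigma l U (W x) *:
  s (star_group U (W x) :^ ((a, c) : G f * G h)).
have UV a b c d : mul (s (U :^ ((a, b) : G f * G g)))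
   (s (V :^ ((c, d) : G g * G h))) = T (b * c^-1)%g a d.
  have -> : (V :^ ((c, d) : G g * G h))%G
          = (W (b * c^-1)%g :^ ((b, d) : G g * G h))%G.
    rewrite conjG_conjG; congr (V :^ _)%G; congr pair => /=.
      by rewrite invMg invgK mulgKV.
    by rewrite invg1 mul1g.
  by rewrite sM starJ sigmaJ.
rewrite mul_suml; under eq_bigr do rewrite mul_sumr.
(* the outer conjugations a and d rebuild the class sum of the star product *)
transitivity (\sum_(b : G g) \sum_(c : G g) \sum_a \sum_d T (b * c^-1)%g a d).
  rewrite sum_pair exchange_big; apply: eq_bigr => b _ /=.
  under eq_bigr do rewrite sum_pair.
  rewrite exchange_big; apply: eq_bigr => c _ /=.
  by do 2![apply: eq_bigr => ? _].
under eq_bigr => b _.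
  rewrite (reindex_inj invg_inj) (reindex_inj (mulgI b^-1)%g) /=.
  under eq_bigr => x _ do rewrite invgK mulKVg.
  over.
rewrite sumr_const -scaler_nat; congr (_ *: _); apply: eq_bigr => x _.
by rewrite scaler_sumr sum_pair.
Qed.

End OrbitSums.

(** * The embedding of Gamma in Lambda *)

Section Embedding.

Variables (K : fieldType) (I : choiceType) (G : I -> finGroupType) (l : nat -> K).

Local Notation mulL := (@Lambda_mul K I G l).
Local Notation mulG := (@Gamma_mul K I G l).
Local Notation osum := (orbit_sum (@sgen K I G)).

Lemma Lambda_mulPl y : linear (mulL ^~ y). Proof. exact: bilinPl. Qed.
Lemma Lambda_mulPr x : linear (mulL x). Proof. exact: bilinPr. Qed.
Lemma Gamma_mulPl y : linear (mulG ^~ y). Proof. exact: bilinPl. Qed.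
Lemma Gamma_mulPr x : linear (mulG x). Proof. exact: bilinPr. Qed.

Lemma csymb_basis_ind (P : csymb G -> Prop) :
  (forall f g (U : {group G f * G g}), P (\pi_(csymb G) (Symb U))%qT) ->
  forall c, P c.
Proof.
move=> PU c; rewrite -[c]reprK; case: (generic_quotient.repr c) => [[f g] U].
exact: PU.
Qed.

Section DoubleCosets.

Variables (f g h : I) (U : {group G f * G g}) (V : {group G g * G h}).

Definition dcoset x := (right_im U :* x * left_im V)%g.

Lemma dcosetP y x : reflect (exists u v,
  [/\ u \in right_im U, v \in left_im V & y = (u * x * v)%g]) (y \in dcoset x).
Proof.
apply: (iffP idP) => [/mulsgP[_ v /rcosetP[u Uu ->] Vv ->]|[u [v [Uu Vv ->]]]].
  by exists u, v.
by rewrite !mem_mulg // set11.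
Qed.

Lemma mem_dcoset x : x \in dcoset x.
Proof.
by apply/dcosetP; exists 1%g, 1%g; rewrite mul1g mulg1 !group1.
Qed.

Lemma dcoset_eq x y : y \in dcoset x -> dcoset y = dcoset x.
Proof.
case/dcosetP=> u [v [Uu Vv ->]]; rewrite /dcoset -!mulg_set1.
rewrite !mulgA rcoset_id // -!mulgA.
by congr (_ * (_ * _))%g; apply: lcoset_id.
Qed.

Lemma dterm_dcoset x y : y \in dcoset x -> dterm l U V y = dterm l U V x.
Proof.
case/dcosetP=> u [v [Uu Vv ->]]; rewrite -(dtermJ l 1%g 1%g x Uu Vv) !conjG_id.
by rewrite invg1 mul1g mulg1.
Qed.

Hypothesis K_char0 : [pchar K] =i pred0.

(** A sum over double cosets becomes a sum over the group when each element is
    weighted by the inverse of the size of its double coset; no representative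
    has to be chosen any more. *)
Lemma dmul_sum :
  dmul l U V = \sum_(x : G g) #|dcoset x|%:R^-1 *: dterm l U V x.
Proof.
rewrite (partition_big dcoset (mem [set dcoset x | x : G g])) /=; last first.
  by move=> x _; apply: imset_f.
apply: eq_bigr => _ /imsetP[y _ ->].
have eq_dc x : (dcoset x == dcoset y) = (x \in dcoset y).
  by apply/eqP/idP => [<-|/dcoset_eq//]; apply: mem_dcoset.
rewrite (eq_bigl _ _ eq_dc) (dterm_dcoset (mem_repr _ (mem_dcoset y))).
rewrite (eq_bigr (fun=> #|dcoset y|%:R^-1 *: dterm l U V y)) => [|x yx]; last first.
  by rewrite (dcoset_eq yx) (dterm_dcoset yx).
rewrite sumr_const -scaler_nat scalerA divff ?scale1r //.
apply: (natr_neq0 K_char0); apply/card_gt0P; exists y; exact: mem_dcoset.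
Qed.

(** Translated by x^-1, the double coset is the product of the right projection of
    [U] and the left projection of [W], to which [card_star] applies. *)
Lemma card_dcoset x (W := (V :^ ((x, 1%g) : G g * G h)^-1)%G) :
  (#|dcoset x| * #|star U W| * #|right_ker U :&: left_ker W|)%N = (#|U| * #|V|)%N.
Proof.
have <- : #|W| = #|V| by apply: cardJg.
rewrite -card_star; congr (_ * _ * _)%N; rewrite -(card_rcoset _ x^-1).
by rewrite left_imJ /= conjsgE invgK /dcoset !mulgA.
Qed.

End DoubleCosets.

(** The image of d_U is |G| / |U| e_F s_U e_G.  The scalar |G| / |U| turns
    [card_star] into multiplicativity; it equals 1 on the identity d_(Delta_1). *)
Definition embed : Gamma K G -> Lambda K G :=
  lext (fun c : csymb G => let: existT p U := (generic_quotient.repr c : symb G) in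
                 (#|G p.1| * #|U|)%:R^-1 *: osum U).

(** [retract] is a left inverse of [embed], and [embed \o retract] is the
    averaging y |-> e_F y e_G on the span of the symbols of subgroups of F x G. *)
Definition retract : Lambda K G -> Gamma K G :=
  lext (fun c : symb G => let: existT p U := c in (#|U|%:R / #|G p.2|%:R) *: dgen K U).

HB.instance Definition _ := GRing.Linear.on embed.
HB.instance Definition _ := GRing.Linear.on retract.

Lemma embed_dgen f g (U : {group G f * G g}) :
  embed (dgen K U) = (#|G f| * #|U|)%:R^-1 *: osum U.
Proof.
rewrite /embed /dgen lextU; have [a ->] := repr_csymb U.
by rewrite /= orbit_sumJ cardJg.
Qed.

Lemma retract_sgen f g (U : {group G f * G g}) :
  retract (sgen K U) = (#|U|%:R / #|G g|%:R) *: dgen K U.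
Proof. by rewrite /retract /sgen lextU. Qed.

Section Char0.

Hypothesis K_char0 : [pchar K] =i pred0.

Lemma embedK : cancel embed retract.
Proof.
apply: (@eq_linear_basis K (csymb G) (Gamma K G) (retract \o embed) idfun) => //.
  by move=> a u v; rewrite /= !linearP.
apply: csymb_basis_ind => f g U; rewrite -/(dgen K U) /= embed_dgen linearZ linear_sum /=.
under eq_bigr => a _.
  rewrite retract_sgen cardJg; have <- : dgen K U = dgen K (U :^ a).
    by apply/dgen_eq; exists a.
  over.
rewrite sumr_const card_prod -scaler_nat !scalerA.
set k := (X in X *: _ = _).
have -> : k = 1.
  rewrite /k !natrM; field.
  by rewrite (natr_card_neq0 K_char0) !(natr_cardT_neq0 K_char0).
exact: scale1r.
Qed.

(** On the basis both sides are sums over x in G of multiples of the class sum of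
    U * V^(x^-1, 1); the coefficients agree by [card_dcoset]. *)
Lemma embedM x y : embed (mulG x y) = mulL (embed x) (embed y).
Proof.
move: x; apply: (@eq_linear_basis K (csymb G) (Lambda K G)
  (fun x => embed (mulG x y)) (fun x => mulL (embed x) (embed y))).
- by move=> a u v; rewrite Gamma_mulPl linearP.
- by move=> a u v; rewrite linearP Lambda_mulPl.
move=> c; move: y; apply: (@eq_linear_basis K (csymb G) (Lambda K G)
  (fun y => embed (mulG _ y)) (fun y => mulL _ (embed y))).
- by move=> a u v; rewrite Gamma_mulPr linearP.
- by move=> a u v; rewrite linearP Lambda_mulPr.
move: c; apply: csymb_basis_ind => f g U; apply: csymb_basis_ind => g' h V.
rewrite -/(dgen K U) -/(dgen K V).
rewrite [X in _ = mulL X _]embed_dgen [X in _ = mulL _ X]embed_dgen.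
rewrite [RHS](linZ (Lambda_mulPl _)) [X in _ = _ *: X](linZ (Lambda_mulPr _)).
case: (eq_comparable g g') => [e|ne]; last first.
  rewrite [X in embed X]dgenM0 // linear0.
  rewrite (orbit_sumM0 Lambda_mulPl Lambda_mulPr (@sgenM0 K I G l) U V ne).
  by rewrite !scaler0.
case: g' / e V => V.
rewrite [X in embed X]dgenM dmul_sum //.
rewrite (orbit_sumM Lambda_mulPl Lambda_mulPr (@sgenM K I G l)).
rewrite linear_sum !scalerA scaler_sumr; apply: eq_bigr => x _ /=.
rewrite linearZ /dterm linearZ /= embed_dgen !scalerA /sigma.
set W := conjG_group V _.
have lkW : left_ker W = (left_ker V :^ x^-1)%g := left_kerJ V x^-1%g 1^-1%g.
rewrite -lkW; apply: scale_congr.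
have cardUV : #|dcoset U V x|%:R * #|star U W|%:R * #|right_ker U :&: left_ker W|%:R
            = #|U|%:R * #|V|%:R :> K.
  by rewrite -!natrM card_dcoset.
rewrite natrM.
have [u0 v0] := (natr_card_neq0 K_char0 U, natr_card_neq0 K_char0 V).
have := mulf_neq0 u0 v0; rewrite -cardUV !mulf_eq0 !negb_or => /andP[/andP[d0 s0] n0].
have [f0 g0] := (natr_cardT_neq0 K_char0 (G f), natr_cardT_neq0 K_char0 (G g)).
(* the common value of the two coefficients, free of double cosets *)
transitivity (l #|right_ker U :&: left_ker W| / (#|G f|%:R * (#|U|%:R * #|V|%:R))).
  rewrite -cardUV; field.
  by apply/and4P; split.
field.
by apply/and4P; split.
Qed.

Lemma embed_retract_sgen g h (V : {group G g * G h}) :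
  embed (retract (sgen K V)) = (#|G g| * #|G h|)%:R^-1 *: osum V.
Proof.
rewrite [X in embed X]retract_sgen linearZ [X in _ *: X = _]embed_dgen scalerA.
apply: scale_congr; rewrite !natrM.
have [v0 g0] := (natr_card_neq0 K_char0 V, natr_cardT_neq0 K_char0 (G g)).
have h0 := natr_cardT_neq0 K_char0 (G h); field.
by rewrite v0 g0 h0.
Qed.

(** The outer factors are combinations of class sums, which only see the average
    of [b]. *)
Lemma embed_retractM x y b :
  mulL (mulL (embed x) (embed (retract b))) (embed y) =
  mulL (mulL (embed x) b) (embed y).
Proof.
move: b; apply: (@eq_linear_basis K (symb G) (Lambda K G)
  (fun b => mulL (mulL (embed x) (embed (retract b))) (embed y))
  (fun b => mulL (mulL (embed x) b) (embed y))).
- by move=> a u v; rewrite !linearP Lambda_mulPr Lambda_mulPl.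
- by move=> a u v; rewrite Lambda_mulPr Lambda_mulPl.
move=> [[g' h] V]; move: x; apply: (@eq_linear_basis K (csymb G) (Lambda K G)
  (fun x => mulL (mulL (embed x) _) (embed y))
  (fun x => mulL (mulL (embed x) _) (embed y))).
- by move=> a u v; rewrite linearP !Lambda_mulPl.
- by move=> a u v; rewrite linearP !Lambda_mulPl.
move=> c; move: y; apply: (@eq_linear_basis K (csymb G) (Lambda K G)
  (fun y => mulL (mulL (embed _) _) (embed y))
  (fun y => mulL (mulL (embed _) _) (embed y))).
- by move=> a u v; rewrite linearP Lambda_mulPr.
- by move=> a u v; rewrite linearP Lambda_mulPr.
move: c; apply: csymb_basis_ind => f g U; apply: csymb_basis_ind => h' k W.
rewrite -/(dgen K U) -/(dgen K W) -/(sgen K V).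
have mul3_congr x y z x' y' z' : x = x' -> y = y' -> z = z' ->
    mulL (mulL x y) z = mulL (mulL x' y') z'.
  by move=> -> -> ->.
rewrite [LHS](mul3_congr _ _ _ _ _ _
  (embed_dgen U) (embed_retract_sgen V) (embed_dgen W)).
rewrite [RHS](mul3_congr _ _ _ _ _ _ (embed_dgen U) (erefl _) (embed_dgen W)).
rewrite [LHS](orbit_sum_average Lambda_mulPl Lambda_mulPr
  (@sgenM K I G l) (@sgenM0 K I G l)).
rewrite mulVf; first exact: scale1r.
by rewrite natrM mulf_neq0 ?(natr_cardT_neq0 K_char0).
Qed.

(** * Local units of Gamma *)

Section Identities.

Hypothesis l1 : l 1%N = 1.

(** Delta_1, the identity for the star product. *)
Definition diag f : {set G f * G f} := [set x | x.1 == x.2].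

Lemma diag_group_set f : group_set (diag f).
Proof.
apply/group_setP; split=> [|[x x'] [y y']]; rewrite !inE //=.
by move=> /eqP-> /eqP->.
Qed.

Canonical diag_group f := Group (diag_group_set f).

Lemma star_diagl f g (U : {group G f * G g}) : star_group (diag_group f) U = U.
Proof.
apply: val_inj; apply/setP=> -[x y]; rewrite !inE /=.
apply/existsP/idP=> [[z]|Uxy]; first by rewrite inE /= => /andP[/eqP->].
by exists x; rewrite inE /= eqxx.
Qed.

Lemma star_diagr f g (U : {group G f * G g}) : star_group U (diag_group g) = U.
Proof.
apply: val_inj; apply/setP=> -[x y]; rewrite !inE /=.
apply/existsP/idP=> [[z]|Uxy]; first by rewrite inE /= => /andP[? /eqP<-].
by exists y; rewrite inE /= eqxx andbT.
Qed.

(** There is a single double coset, as the diagonal projects onto the whole group,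
    and its coefficient is l 1 / 1 = 1, as the diagonal has trivial kernels. *)
Lemma dmul_diagl f g (U : {group G f * G g}) : dmul l (diag_group f) U = dgen K U.
Proof.
rewrite dmul_sum // (eq_bigr (fun=> #|G f|%:R^-1 *: dgen K U)).
  rewrite sumr_const -scaler_nat scalerA divff ?(natr_cardT_neq0 K_char0) //.
  exact: scale1r.
move=> x _; have -> : dcoset (diag_group f) U x = [set: G f].
  apply/setP=> y; rewrite inE; apply/dcosetP; exists (y * x^-1)%g, 1%g.
  rewrite mulg1 mulgKV group1; split=> //.
  by apply/imsetP; exists (y * x^-1, y * x^-1)%g; rewrite ?inE.
have rk1 : right_ker (diag_group f) = 1%g by apply/setP=> y; rewrite !inE eq_sym.
rewrite cardsT /dterm star_diagl rk1.
have /setIidPl-> : ([1 G f] \subset left_ker U :^ x^-1)%g.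
  by rewrite sub1set mem_conjg conj1g inE group1.
rewrite cards1 l1 divr1; congr (_ *: _); rewrite scale1r; symmetry.
by apply/dgen_eq; exists ((x, 1%g) : G f * G g)^-1%g.
Qed.

Lemma dmul_diagr f g (U : {group G f * G g}) : dmul l U (diag_group g) = dgen K U.
Proof.
rewrite dmul_sum // (eq_bigr (fun=> #|G g|%:R^-1 *: dgen K U)).
  rewrite sumr_const -scaler_nat scalerA divff ?(natr_cardT_neq0 K_char0) //.
  exact: scale1r.
move=> x _; have -> : dcoset U (diag_group g) x = [set: G g].
  apply/setP=> y; rewrite inE; apply/dcosetP; exists 1%g, (x^-1 * y)%g.
  rewrite mul1g mulKVg group1; split=> //.
  by apply/imsetP; exists (x^-1 * y, x^-1 * y)%g; rewrite ?inE.
have lk1 : left_ker (diag_group g) = 1%g by apply/setP=> y; rewrite !inE.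
rewrite cardsT /dterm lk1 conjs1g.
have /setIidPr-> : ([1 G g]%g \subset right_ker U) by rewrite sub1set inE group1.
rewrite cards1 l1 divr1; congr (_ *: _); rewrite scale1r; symmetry.
(* the diagonal is invariant under (x, x), so the conjugation by (x^-1, 1) can be
   moved to the outer component, where it does not change the class *)
have -> : (diag_group g :^ ((x, 1%g) : G g * G g)^-1)%G
        = (diag_group g :^ ((1%g, x) : G g * G g))%G.
  apply: val_inj; apply/setP=> -[y z]; rewrite !mem_conjg !inE /=.
  rewrite !(invgK, invg1, mul1g, mulg1); apply/eqP/eqP => [<-|->].
    by rewrite !mulgA mulgV mul1g mulgK.
  by rewrite !mulgA mulVg mul1g mulgKV.
rewrite -[in RHS](conjG_id U) (starJ U _ 1%g 1%g x) star_diagr.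
by apply/dgen_eq; exists ((1%g, x) : G f * G g).
Qed.

Definition identity_on (J : seq I) : Gamma K G := \sum_(f <- J) dgen K (diag_group f).

Lemma identity_on_dgen J f g (U : {group G f * G g}) : uniq J -> f \in J ->
  mulG (identity_on J) (dgen K U) = dgen K U.
Proof.
move=> uniqJ Jf; rewrite [LHS](lin_sum (Gamma_mulPl (dgen K U))).
rewrite (bigD1_seq f) //= [X in X + _]dgenM dmul_diagl big1 ?addr0 // => f' ne.
by apply: dgenM0; apply/eqP.
Qed.

Lemma dgen_identity_on J f g (U : {group G f * G g}) : uniq J -> g \in J ->
  mulG (dgen K U) (identity_on J) = dgen K U.
Proof.
move=> uniqJ Jg; rewrite [LHS](lin_sum (Gamma_mulPr (dgen K U))).
rewrite (bigD1_seq g) //= [X in X + _]dgenM dmul_diagr big1 ?addr0 // => g' ne.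
by apply: dgenM0; apply/eqP; rewrite eq_sym.
Qed.

Definition endpoints (c : csymb G) : seq I :=
  let: existT p _ := (generic_quotient.repr c : symb G) in [:: p.1; p.2].

Lemma identity_onP J x : uniq J ->
  (forall c, c \in msupp x -> {subset endpoints c <= J}) ->
  mulG (identity_on J) x = x /\ mulG x (identity_on J) = x.
Proof.
move=> uniqJ Jx; rewrite (malg_basisE x).
have dgenP c : c \in msupp x -> exists f g (U : {group G f * G g}),
    [/\ f \in J, g \in J & << c >> = dgen K U].
  move=> /Jx; rewrite /endpoints /dgen; rewrite -[c in << c >>]reprK.
  case: (generic_quotient.repr c) => -[f g] U Jc; exists f, g, U.
  by split; rewrite // Jc // !inE eqxx ?orbT.
split.
  rewrite [LHS](lin_sum (Gamma_mulPr _)); apply: eq_big_seq => c /dgenP.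
  case=> f [g [U [Jf Jg ->]]]; rewrite [LHS](linZ (Gamma_mulPr _)).
  by rewrite [X in _ *: X = _]identity_on_dgen.
rewrite [LHS](lin_sum (Gamma_mulPl _)); apply: eq_big_seq => c /dgenP.
case=> f [g [U [Jf Jg ->]]]; rewrite [LHS](linZ (Gamma_mulPl _)).
by rewrite [X in _ *: X = _]dgen_identity_on.
Qed.

Lemma Gamma_locally_unital : locally_unital mulG.
Proof.
move=> s.
pose J := undup (flatten [seq flatten [seq endpoints c | c <- msupp x] | x <- s]).
have uniqJ : uniq J := undup_uniq _.
exists (identity_on J).
  rewrite /idem [LHS](lin_sum (Gamma_mulPr _)); apply: eq_big_seq => f Jf.
  exact: identity_on_dgen.
move=> x sx; exists x.
have [] := @identity_onP J x uniqJ; last by move=> -> ->.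
move=> c xc f cf; rewrite mem_undup; apply/flatten_mapP; exists x => //.
by apply/flatten_mapP; exists c.
Qed.

End Identities.

(** * Descent to Gamma *)

(** With e' = embed e, the element (e' b) e' is the image of (e c) e for
    c = retract b, by [embed_retractM]. *)
Lemma corner_embed e y : corner mulL (embed e) y ->
  exists2 x, corner mulG e x & y = embed x.
Proof.
case=> b ->; exists (mulG (mulG e (retract b)) e); first by exists (retract b).
by rewrite [RHS]embedM [X in _ = mulL X _]embedM embed_retractM.
Qed.

End Char0.

End Embedding.

Theorem corollary1p3 (K : fieldType) (I : choiceType) (G : I -> finGroupType)
    (l : nat -> K)
    (K_char0 : [pchar K] =i pred0)
    (I_neq0 : inhabited I)
    (l_unit : forall n : nat, (0 < n)%N -> l n != 0)
    (l1 : l 1%N = 1)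
    (lM : forall m n : nat, (0 < m)%N -> (0 < n)%N -> l (m * n)%N = l m * l n) :
  locally_semisimple (@Lambda_mul K I G l) ->
  locally_semisimple (@Gamma_mul K I G l).
Proof.
case=> _ Lambda_semisimple; split; first exact: Gamma_locally_unital.
move=> e ee; apply: (semisimple_corner_preim (can_inj (embedK K_char0))).
- exact: embedM.
- exact: corner_embed.
- by apply: Lambda_semisimple; rewrite /idem -embedM // ee.
Qed.
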